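(* For every $n\geq 1$, the multivariate polynomial $$T_n(\mathbf{x},\mathbf{y},\mathbf{z})=\sum_{\pi\in\bar Q_n}\prod_{i\in A(\pi)}x_{\pi_i}\prod_{i\in D(\pi)}y_{\pi_i}\prod_{i\in P(\pi)}z_{\pi_i}$$ is stable.
   Context: A polynomial $f\in\mathbb{C}[z_1,\ldots,z_m]$ is called stable if $f(z_1,\ldots,z_m)\neq 0$ whenever $\mathrm{Im}(z_i)>0$ for all $i$. Let $[n]_2$ be the multiset $\{1,1,2,2,\ldots,n,n\}$. A Stirling permutation of $[n]_2$ is a permutation $\pi=\pi_1\cdots\pi_{2n}$ of $[n]_2$ such that if $\pi_i=\pi_j$ then $\pi_k>\pi_i$ whenever $i<k<j$. Set $\pi_0=\pi_{2n+1}=0$. A marked Stirling permutation of $[n]_2$ is a Stirling permutation $\pi$ of $[n]_2$ together with a (possibly empty) set of marked positions, where position $i$ is allowed to be marked only if $\pi_i$ is the second occurrence of its value in $\pi$ (reading from left to right) and $\pi_i<\pi_{i+1}$. Let $\bar Q_n$ be the set of marked Stirling permutations of $[n]_2$. Marks are ignored in all comparisons of entries and in the indices of variables. For $\pi\in\bar Q_n$ define the subsets of $\{1,\ldots,2n\}$: $A(\pi)=\{i:\pi_{i-1}<\pi_i\}$, $D(\pi)=\{i:\pi_i>\pi_{i+1}\}$, $P(\pi)=\{i:\pi_{i-1}=\pi_i\}$. The $x_i,y_i,z_i$ are independent commuting variables. *)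

(* Defs.v *)
From HB Require Import structures.
From mathcomp Require Import all_boot all_order all_algebra.
From mathcomp Require Import complex mpoly.
From mathcomp Require Import reals.

Set Implicit Arguments.
Unset Strict Implicit.
Unset Printing Implicit Defensive.

Import Order.TTheory GRing.Theory Num.Theory.

Local Open Scope ring_scope.

Definition stable (R : realType) (m : nat) (f : {mpoly R[i][m]}) : Prop :=
  forall v : 'I_m -> R[i], (forall i, 0 < complex.Im (v i)) -> f.@[v] != 0.

(* The letter a : 'I_n stands for the value a + 1 of {1, ..., n}, and the index
   i : 'I_n.*2 stands for the position i + 1 of {1, ..., 2n}. *)
Definition word (n : nat) := (n.*2).-tuple 'I_n.

(* entry p k is pi_k with positions numbered from 1 and values in {1, ..., n};
   it is 0 for k = 0 and for k = 2n + 1. Hence for the position of index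
   i : 'I_n.*2, the entries pi_{j-1}, pi_j, pi_{j+1} with j = i + 1 are
   entry p i, entry p i.+1 and entry p i.+2. *)
Definition entry (n : nat) (p : word n) (k : nat) : nat :=
  nth 0%N (0%N :: [seq (val a).+1 | a <- p]) k.

Definition is_stirling (n : nat) (p : word n) : bool :=
  perm_eq p (enum 'I_n ++ enum 'I_n) &&
  [forall i : 'I_n.*2, forall j : 'I_n.*2, forall k : 'I_n.*2,
     [&& tnth p i == tnth p j, i < k & k < j]%N ==> (tnth p i < tnth p k)%N].

Definition second_occurrence (n : nat) (p : word n) (i : 'I_n.*2) : bool :=
  [exists j : 'I_n.*2, (j < i)%N && (tnth p j == tnth p i)].

Definition markable (n : nat) (p : word n) : {set 'I_n.*2} :=
  [set i : 'I_n.*2 | second_occurrence p i && (entry p i.+1 < entry p i.+2)%N].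

(* A pair (p, M) is a word p together with the set M of its marked positions. *)
Definition marked_stirling (n : nat) : {set word n * {set 'I_n.*2}} :=
  [set q : word n * {set 'I_n.*2} | is_stirling q.1 && (q.2 \subset markable q.1)].

Definition ascents (n : nat) (p : word n) : {set 'I_n.*2} :=
  [set i : 'I_n.*2 | (entry p i < entry p i.+1)%N].

Definition descents (n : nat) (p : word n) : {set 'I_n.*2} :=
  [set i : 'I_n.*2 | (entry p i.+2 < entry p i.+1)%N].

Definition plateaux (n : nat) (p : word n) : {set 'I_n.*2} :=
  [set i : 'I_n.*2 | entry p i == entry p i.+1].

(* The 3n variables are ordered as x_1, ..., x_n, y_1, ..., y_n, z_1, ..., z_n. *)
Definition xvar (n : nat) (a : 'I_n) : 'I_(n + n + n) := lshift n (lshift n a).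
Definition yvar (n : nat) (a : 'I_n) : 'I_(n + n + n) := lshift n (rshift n a).
Definition zvar (n : nat) (a : 'I_n) : 'I_(n + n + n) := rshift (n + n) a.

Definition T_poly (R : realType) (n : nat) : {mpoly R[i][n + n + n]} :=
  \sum_(q in marked_stirling n)
    ((\prod_(i in ascents q.1) 'X_(xvar (tnth q.1 i))) *
     (\prod_(i in descents q.1) 'X_(yvar (tnth q.1 i))) *
     (\prod_(i in plateaux q.1) 'X_(zvar (tnth q.1 i)))).

(* Main.v *)
(* A Stirling permutation of [n+1]_2 arises from one of [n]_2 by inserting two
   adjacent letters n+1 in a gap. Each gap (ascent, descent, plateau, including
   the two end gaps) carries one variable, and the insertion replaces it by
   x_{n+1} y_{n+1} z_{n+1}. Summing over the marks gives a factor 2 for each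
   ascent that follows a second occurrence; since a descent always starts at a
   second occurrence,
     T_{n+1} = x_{n+1} y_{n+1} z_{n+1} sum_{i <= n} (d/dx_i + 2 d/dy_i + d/dz_i) T_n.
   The sum is the derivative at t = 0 of g(t) = T_n(x + t, y + 2t, z + t). If T_n
   is stable, then all roots of g have negative imaginary part, hence g'(0) <> 0
   as in the Gauss-Lucas theorem; g is not constant because its coefficient in
   the top degree is T_n(1, 2, 1) > 0. *)
Require Import Defs.
From mathcomp Require Import all_boot all_order all_algebra.
From mathcomp Require Import complex mpoly.
From mathcomp Require Import reals.
From mathcomp Require Import zify ring.

Set Implicit Arguments.
Unset Strict Implicit.
Unset Printing Implicit Defensive.

Import Order.TTheory GRing.Theory Num.Theory.

Local Open Scope ring_scope.

(** * Weights of words, gap by gap *)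

(* [weight seen a s] runs over the gaps of [a :: s]; [seen] holds the letters to
   the left of [a] and tells whether [a] is a second occurrence. The weight of a
   word is that of its extension by the boundary zeros. *)
Section Weights.
Variable A : comNzRingType.
Variables x y z : nat -> A.

Definition gap_weight (second : bool) (a b : nat) : A :=
  if (a < b)%N then x b *+ (if second then 2 else 1)
  else if (b < a)%N then y a else z a.

Fixpoint weight (seen : seq nat) (a : nat) (s : seq nat) : A :=
  if s is b :: s' then gap_weight (a \in seen) a b * weight (a :: seen) b s'
  else 1.

Lemma eq_in_weight seen seen' a s :
  {in a :: s, seen =i seen'} -> weight seen a s = weight seen' a s.
Proof.
elim: s seen seen' a => [//|b s IHs] seen seen' a eq_seen /=.
rewrite eq_seen ?mem_head //; congr (_ * _); apply: IHs => c cs.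
by rewrite !inE eq_seen // inE cs orbT.
Qed.

Lemma weight_nth seen a s :
  weight seen a s = \prod_(k < size s)
    gap_weight (nth 0%N (a :: s) k \in seen ++ take k (a :: s))
      (nth 0%N (a :: s) k) (nth 0%N (a :: s) k.+1).
Proof.
elim: s seen a => [|b s IHs] seen a /=; first by rewrite big_ord0.
rewrite big_ord_recl /= cats0; congr (_ * _).
rewrite IHs; apply: eq_bigr => k _ /=.
by congr gap_weight; rewrite !(inE, mem_cat) orbCA.
Qed.

End Weights.

Lemma eq_weight (A : comNzRingType) (x y z x' y' z' : nat -> A) seen a s :
  x =1 x' -> y =1 y' -> z =1 z' ->
  weight x y z seen a s = weight x' y' z' seen a s.
Proof.
move=> ex ey ez; elim: s seen a => [//|b s IHs] seen a /=.
by rewrite IHs /gap_weight ex ey ez.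
Qed.

Lemma rmorph_weight (A B : comNzRingType) (f : {rmorphism A -> B})
    (x y z : nat -> A) seen a s :
  f (weight x y z seen a s) = weight (f \o x) (f \o y) (f \o z) seen a s.
Proof.
elim: s seen a => [|b s IHs] seen a /=; first by rewrite rmorph1.
rewrite rmorphM IHs /gap_weight; congr (_ * _).
by case: ifP => _; [rewrite rmorphMn|case: ifP].
Qed.

(* In a Stirling permutation a descent starts at a second occurrence and a
   plateau at a first one. *)
Fixpoint well_marked (seen : seq nat) (a : nat) (s : seq nat) : bool :=
  if s is b :: s' then
    [&& (b < a)%N ==> (a \in seen), (a == b) ==> (a \notin seen)
      & well_marked (a :: seen) b s']
  else true.

Lemma eq_in_well_marked seen seen' a s :
  {in a :: s, seen =i seen'} -> well_marked seen a s = well_marked seen' a s.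
Proof.
elim: s seen seen' a => [//|b s IHs] seen seen' a eq_seen /=.
rewrite eq_seen ?mem_head //; congr [&& _, _ & _]; apply: IHs => c cs.
by rewrite !inE eq_seen // inE cs orbT.
Qed.

(** * Insertion of a pair of largest letters, and the recursion *)

Fixpoint insertions (m : nat) (s : seq nat) : seq (seq nat) :=
  (m :: m :: s) ::
  (if s is b :: s' then [seq b :: u | u <- insertions m s'] else [::]).

Lemma insertionsP m s u :
  reflect (exists s1 s2, s = s1 ++ s2 /\ u = s1 ++ m :: m :: s2)
          (u \in insertions m s).
Proof.
elim: s u => [|b s IHs] u /=.
  rewrite inE; apply: (iffP eqP) => [->|[[|? ?] [[|? ?] [//= _ ->]]]] //.
  by exists [::], [::].
rewrite inE; apply: (iffP orP) => [[/eqP->|/mapP[w /IHs[s1 [s2 [-> ->]]] ->]]|].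
- by exists [::], (b :: s).
- by exists (b :: s1), s2.
- move=> [[|c s1] [s2 [/= es ->]]]; first by left; rewrite es.
  case: es => <- es; right; apply/map_f/IHs; by exists s1, s2.
Qed.

Fixpoint stirling_words (n : nat) : seq (seq nat) :=
  if n is n'.+1 then [seq u | s <- stirling_words n', u <- insertions n s]
  else [:: [::]].

Lemma stirling_wordsS n u :
  reflect (exists2 s, s \in stirling_words n & u \in insertions n.+1 s)
          (u \in stirling_words n.+1).
Proof.
apply: (iffP allpairsPdep) => [[s [w [hs hw ->]]]|[s hs hu]]; first by exists s.
by exists s, u.
Qed.

Lemma notin_bounded m s : all (ltn^~ m) s -> m \notin s.
Proof. by move=> /allP lt_s; apply/negP => /lt_s; rewrite /= ltnn. Qed.

(** As [m] exceeds all other letters, the new pair brings an ascent into [m], a plateau at its first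
    occurrence and a descent from its second. Later letters only see [seen] enlarged by [m], which
    is none of them. *)
Lemma well_marked_insertions m seen a s u :
  (a < m)%N -> all (ltn^~ m) seen -> all (ltn^~ m) s ->
  well_marked seen a (rcons s 0) -> u \in insertions m s ->
  well_marked seen a (rcons u 0).
Proof.
have head_case seen0 a0 b t : (a0 < m)%N -> (b < m)%N ->
    all (ltn^~ m) seen0 -> all (ltn^~ m) t ->
    well_marked (a0 :: seen0) b t ->
    well_marked seen0 a0 [:: m, m, b & t].
  move=> lt_am lt_bm lt_seen lt_t wm_t.
  rewrite /= !inE ltnn eqxx (negPf (notin_bounded lt_seen)) !orbF.
  rewrite (ltnNge m) (ltnW lt_am) (ltn_eqF lt_am) (gtn_eqF lt_am) (gtn_eqF lt_bm).
  rewrite implybT /= -(eq_in_well_marked (seen := a0 :: seen0)) ?implybT // => c.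
  rewrite !inE => /predU1P c_in.
  suff /negPf-> : c != m by [].
  by rewrite neq_ltn; case: c_in => [->|/(allP lt_t)/= ->] //; rewrite lt_bm.
elim: s seen a u => [|b s IHs] seen a u lt_am lt_seen /=.
  rewrite andbT inE => _ wm /eqP-> /=.
  by have := @head_case seen a 0%N [::] lt_am (leq_ltn_trans (leq0n a) lt_am)
     lt_seen isT isT.
case/andP=> lt_bm lt_s /and3P[desc plat wm_s].
rewrite inE => /predU1P[->|/mapP[w w_in ->]] /=.
  apply: (head_case _ _ _ (rcons s 0%N)) => //.
  by rewrite all_rcons lt_s /= (leq_ltn_trans (leq0n a) lt_am).
by rewrite desc plat IHs //= lt_am.
Qed.

(* Inserting [m m] in a gap replaces its weight by [x m * z m * y m], up to the
   factor 2 of an ascent that follows a second occurrence; a descent turns into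
   such an ascent, whence the derivative 2 of the [y]'s. *)
Lemma weight_insertions (A : comNzRingType) (x y z : nat -> {poly A}) m seen a s :
  (forall b, (x b)^`() = 1) -> (forall b, (y b)^`() = 2%:R) ->
  (forall b, (z b)^`() = 1) ->
  (a < m)%N -> all (ltn^~ m) seen -> all (ltn^~ m) s ->
  well_marked seen a (rcons s 0) ->
  \sum_(u <- insertions m s) weight x y z seen a (rcons u 0) =
  x m * y m * z m * (weight x y z seen a (rcons s 0))^`().
Proof.
move=> dx dy dz.
have head_case seen0 a0 b t : (a0 < m)%N -> (b < m)%N ->
    all (ltn^~ m) seen0 -> all (ltn^~ m) t ->
    (b < a0)%N ==> (a0 \in seen0) -> (a0 == b) ==> (a0 \notin seen0) ->
    weight x y z seen0 a0 [:: m, m, b & t] =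
    x m * y m * z m * ((gap_weight x y z (a0 \in seen0) a0 b)^`()
                       * weight x y z (a0 :: seen0) b t).
  move=> lt_am lt_bm lt_seen lt_t desc plat.
  (* No letter after the new pair equals [m], so having seen [m] does not change their weights. *)
  rewrite /= -(@eq_in_weight _ x y z (a0 :: seen0)); last first.
    move=> c c_in; rewrite [in RHS]inE [in RHS]inE.
    suff /negPf-> : c != m by [].
    move: c_in; rewrite inE neq_ltn => /predU1P[->|/(allP lt_t)/= ->] //.
    by rewrite lt_bm.
  rewrite /gap_weight lt_am ltnn (ltnNge m b) (ltnW lt_bm) /= lt_bm.
  (* At a descent [a0] is a second occurrence, and the new ascent into [m] has the factor 2 of [dy].
     At an ascent the old factor passes to the new ascent. At a plateau [a0] is a first occurrence,
     with factor 1. *)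
  case: ltngtP desc plat => [lt|lt|eq] /=.
  - by move=> -> _; rewrite dy; ring.
  - by move=> _ _; rewrite derivMn dx; case: ifP => _; ring.
  - by move=> _ /negPf->; rewrite dz; ring.
elim: s seen a => [|b s IHs] seen a lt_am lt_seen.
  move=> _ /= /and3P[desc plat _]; rewrite big_seq1 mulr1.
  have := head_case seen a 0%N [::] lt_am (leq_ltn_trans (leq0n a) lt_am)
     lt_seen isT desc plat.
  by rewrite /= !mulr1 => ->.
rewrite [all _ _]/= => /andP[lt_bm lt_s] /= /and3P[desc plat wm_s].
(* Leibniz rule: inserting right after [a] matches the derivative of the first factor, inserting
   further on that of the rest. *)
rewrite big_cons big_map derivM mulrDr; congr (_ + _).
  apply: head_case => //.
  by rewrite all_rcons lt_s /= (leq_ltn_trans (leq0n a) lt_am).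
rewrite -big_distrr /= IHs //= ?lt_am //; ring.
Qed.

Lemma well_marked_stirling_words n s :
  s \in stirling_words n -> all (ltn^~ n.+1) s /\ well_marked [::] 0 (rcons s 0).
Proof.
elim: n s => [|n IHn] s; first by rewrite inE => /eqP->.
move=> /stirling_wordsS[r /IHn[lt_r wm_r] s_in]; split; last first.
  exact: well_marked_insertions s_in.
case/insertionsP: s_in lt_r => [s1 [s2 [-> ->]]].
rewrite !all_cat /= ltnSn => /andP[lt1 lt2].
by apply/and3P; split=> //; [apply: sub_all lt1|apply: sub_all lt2] => c /ltnW.
Qed.

(* At [n = 0] this is [z 0], from the gap between the two boundary zeros; its
   derivative 1 makes the recursion of [stirling_sumS] valid from [n = 0] on. *)
Definition stirling_sum (A : comNzRingType) (x y z : nat -> A) (n : nat) : A :=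
  \sum_(s <- stirling_words n) weight x y z [::] 0 (rcons s 0).

Lemma stirling_sumS (A : comNzRingType) (x y z : nat -> {poly A}) n :
  (forall b, (x b)^`() = 1) -> (forall b, (y b)^`() = 2%:R) ->
  (forall b, (z b)^`() = 1) ->
  stirling_sum x y z n.+1 =
  x n.+1 * y n.+1 * z n.+1 * (stirling_sum x y z n)^`().
Proof.
move=> dx dy dz; rewrite /stirling_sum (raddf_sum (@deriv A)) big_distrr /=.
rewrite big_allpairs_dep /=; apply: eq_big_seq => s /well_marked_stirling_words[*].
exact: weight_insertions.
Qed.

Lemma rmorph_stirling_sum (A B : comNzRingType) (f : {rmorphism A -> B})
    (x y z : nat -> A) n :
  f (stirling_sum x y z n) = stirling_sum (f \o x) (f \o y) (f \o z) n.
Proof. by rewrite rmorph_sum; apply: eq_bigr => s _; apply: rmorph_weight. Qed.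

Lemma eq_stirling_sum (A : comNzRingType) (x y z x' y' z' : nat -> A) n :
  x =1 x' -> y =1 y' -> z =1 z' -> stirling_sum x y z n = stirling_sum x' y' z' n.
Proof. by move=> ex ey ez; apply: eq_bigr => s _; apply: eq_weight. Qed.

(** * Degree and leading coefficient along a line of positive direction *)

Section LeadingCoefficient.
Variable A : numDomainType.

Definition affine (d c : A) : {poly A} := c%:P + d *: 'X.

(** In [R[i]], [0 < c] means that [c] is real and positive, so top coefficients cannot cancel in a
    sum. *)
Definition pos_lead (k : nat) (p : {poly A}) : bool :=
  (size p <= k.+1)%N && (0 < p`_k).

Lemma pos_leadM k p (c d : A) :
  0 < d -> pos_lead k p -> pos_lead k.+1 (affine d c * p).
Proof.
move=> d_gt0 /andP[sz_p p_gt0]; apply/andP; split.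
  apply: leq_trans (size_polyMleq _ _) _.
  have: (size (affine d c) <= 2)%N.
    rewrite /affine addrC -mul_polyC size_MXaddC; case: ifP => // _.
    by rewrite ltnS size_polyC leq_b1.
  lia.
rewrite mulrDl coefD coefCM -scalerAl coefZ coefXM /= nth_default ?mulr0 ?add0r //.
exact: mulr_gt0.
Qed.

Lemma pos_lead_sum k (I : eqType) (s : seq I) (F : I -> {poly A}) :
  s != [::] -> {in s, forall i, pos_lead k (F i)} -> pos_lead k (\sum_(i <- s) F i).
Proof.
elim: s => [//|i s IHs] _ posF; rewrite big_cons.
have /andP[sz_i pos_i] := posF i (mem_head _ _).
case: (eqVneq s [::]) => [->|s_neq0]; first by rewrite big_nil addr0 /pos_lead sz_i.
have /andP[sz_s pos_s] : pos_lead k (\sum_(j <- s) F j).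
  by apply: IHs => // j js; apply: posF; rewrite inE js orbT.
apply/andP; split; last by rewrite coefD addr_gt0.
by apply: leq_trans (size_polyD _ _) _; rewrite geq_max sz_i.
Qed.

Lemma pos_lead_weight (dx dy dz : A) (x y z : nat -> A) seen a s :
  0 < dx -> 0 < dy -> 0 < dz ->
  pos_lead (size s)
    (weight (affine dx \o x) (affine dy \o y) (affine dz \o z) seen a s).
Proof.
move=> dx_gt0 dy_gt0 dz_gt0; elim: s seen a => [|b s IHs] seen a /=.
  by rewrite /pos_lead size_poly1 coef1 ltr01.
rewrite /gap_weight; case: ifP => _ /=; last by case: ifP => _; apply: pos_leadM.
(* The factor 1 or 2 of an ascent is absorbed into the slope and the constant of the affine
   polynomial. *)
rewrite mulrnDl -polyCMn scalerMnl -/(affine _ _).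
by apply: pos_leadM => //; rewrite pmulrn_lgt0 //; case: (a \in seen).
Qed.

End LeadingCoefficient.

Lemma size_insertions m s u : u \in insertions m s -> size u = (size s).+2.
Proof. by move=> /insertionsP[s1 [s2 [-> ->]]]; rewrite !size_cat /= !addnS. Qed.

Lemma size_stirling_words n s : s \in stirling_words n -> size s = n.*2.
Proof.
elim: n s => [|n IHn] s; first by rewrite inE => /eqP->.
by move=> /stirling_wordsS[r /IHn sz_r /size_insertions->]; rewrite sz_r.
Qed.

Lemma stirling_words_neq0 n : stirling_words n != [::].
Proof.
suff [s] : exists s, s \in stirling_words n by case: (stirling_words n).
elim: n => [|n [s s_in]]; first by exists [::].
exists (n.+1 :: n.+1 :: s); apply/stirling_wordsS; exists s => //.
by apply/insertionsP; exists [::], s.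
Qed.

(** * Nonvanishing on the upper half-plane *)

Section Stability.
Variable R : realType.

Lemma ImD (u v : R[i]) : complex.Im (u + v) = complex.Im u + complex.Im v.
Proof. by case: u v => [? ?] [? ?]. Qed.

Lemma Im_mulrn (u : R[i]) k : complex.Im (u *+ k) = complex.Im u *+ k.
Proof. by elim: k => [//|k IHk]; rewrite !mulrS ImD IHk. Qed.

(** Since [-1 / r] is minus the conjugate of [r] over [|r|^2], its imaginary part has the sign of
    that of [r]. *)
Lemma Im_opp_inv_lt0 (r : R[i]) : complex.Im r < 0 -> complex.Im (- r)^-1 < 0.
Proof.
case: r => a b /= b_lt0; rewrite -mulNr opprK sqrrN nmulr_rlt0 // invr_gt0.
by rewrite ltr_wpDl ?sqr_ge0 // sqrrN exprn_even_gt0 //= lt_eqF.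
Qed.

(* Gauss-Lucas at the point 0: [p'(0) / p(0)] is the sum of the [-1 / r] over the
   roots [r] of [p]. *)
Lemma deriv0_neq0 (p : {poly R[i]}) :
  (1 < size p)%N -> (forall r, root p r -> complex.Im r < 0) -> p^`().[0] != 0.
Proof.
move=> sz_p roots_p; have [rs def_p] := closed_field_poly_normal p.
have lc_neq0 : lead_coef p != 0 by rewrite lead_coef_eq0 -size_poly_gt0 ltnW.
have {roots_p} : all (fun r => complex.Im r < 0) rs.
  apply/allP => r r_in; apply: roots_p.
  by rewrite def_p rootZ // root_prod_XsubC.
have {sz_p} : rs != [::].
  apply: contraTneq sz_p => rs0.
  by rewrite def_p rs0 big_nil alg_polyC size_polyC lc_neq0.
rewrite def_p derivZ hornerZ mulf_eq0 negb_or lc_neq0 /=.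
set q := fun rs => \prod_(r <- rs) ('X - r%:P) : {poly R[i]}.
have q0 s : all (fun r => complex.Im r < 0) s -> (q s).[0] != 0.
  move=> /allP Im_s; rewrite -rootE root_prod_XsubC.
  by apply/negP => /Im_s; rewrite /= ltxx.
suff Im_q s : all (fun r => complex.Im r < 0) s -> s != [::] ->
    complex.Im ((q s)^`().[0] / (q s).[0]) < 0.
  move=> rs_neq0 Im_rs; apply/eqP => q'0.
  by have := Im_q _ Im_rs rs_neq0; rewrite q'0 mul0r /= ltxx.
elim: s => [//|r s IHs] /= /andP[Im_r Im_s] _.
have -> : (q (r :: s))^`().[0] / (q (r :: s)).[0] =
    (- r)^-1 + (q s)^`().[0] / (q s).[0].
  have r_neq0 : r != 0 by apply: contraTneq Im_r => ->; rewrite /= ltxx.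
  rewrite /q big_cons -/(q s) derivM derivXsubC mul1r !hornerE.
  by field; rewrite q0 // r_neq0.
rewrite ImD; have Im_inv := Im_opp_inv_lt0 Im_r.
case: (eqVneq s [::]) => [->|s_neq0]; last first.
  by rewrite -[X in _ < X]addr0 ltrD // IHs.
by rewrite /q big_nil derivC horner0 mul0r addr0.
Qed.

Lemma stirling_sum_neq0 n (x y z : nat -> R[i]) :
  (forall b, 0 < complex.Im (x b)) -> (forall b, 0 < complex.Im (y b)) ->
  (forall b, 0 < complex.Im (z b)) -> stirling_sum x y z n != 0.
Proof.
elim: n x y z => [|n IHn] x y z Im_x Im_y Im_z.
  rewrite /stirling_sum big_seq1 /= mulr1 /gap_weight ltnn.
  by apply: contraTneq (Im_z 0%N) => ->; rewrite ltxx.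
have Im_neq0 (c : R[i]) : 0 < complex.Im c -> c != 0.
  by apply: contraTneq => ->; rewrite ltxx.
(* The line through the point in direction (1, 2, 1) has the derivatives that [stirling_sumS] asks
   for. *)
pose X := affine 1 \o x; pose Y := affine 2%:R \o y; pose Z := affine 1 \o z.
have ev (u : nat -> R[i]) d t :
    horner_eval t \o (affine d \o u) =1 (fun b => u b + d * t).
  by move=> b; rewrite /= /horner_eval !hornerE.
have ev0 (u : nat -> R[i]) d : horner_eval 0 \o (affine d \o u) =1 u.
  by move=> b; rewrite ev mulr0 addr0.
have dlin (u : nat -> R[i]) d b : ((affine d \o u) b)^`() = d%:P.
  by rewrite /= derivD derivC derivZ derivX add0r alg_polyC.
have -> : stirling_sum x y z n.+1 = (stirling_sum X Y Z n.+1).[0].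
  rewrite -[RHS]/(horner_eval 0 _) rmorph_stirling_sum.
  by apply: eq_stirling_sum => b; rewrite ev0.
rewrite stirling_sumS; try by move=> b; rewrite dlin // rmorph_nat.
rewrite !hornerM !mulf_neq0 //.
- by rewrite /= !hornerE Im_neq0.
- by rewrite /= !hornerE Im_neq0.
- by rewrite /= !hornerE Im_neq0.
apply: deriv0_neq0 => [|r].
  (* A word of length [2n] has [2n + 1] gaps, so the degree is positive even for [n = 0]. *)
  have /andP[_] : pos_lead n.*2.+1 (stirling_sum X Y Z n).
    apply: pos_lead_sum (stirling_words_neq0 n) _ => s /size_stirling_words <-.
    rewrite -(size_rcons s 0%N); apply: pos_lead_weight => //; exact: ltr0n.
  apply: contraTltn => sz; rewrite nth_default ?ltxx //.
  by apply: leq_trans sz _.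
(* If [Im r >= 0], every [u b + d * r] stays in the open upper half-plane, and the induction
   hypothesis applies at the translated point. *)
rewrite ltNge; apply: contraTN => Im_r; rewrite rootE -[_.[r]]/(horner_eval r _).
rewrite rmorph_stirling_sum (eq_stirling_sum _ (ev _ _ _) (ev _ _ _) (ev _ _ _)).
apply: IHn => b; rewrite ?mul1r ?mulr_natl ImD ltr_wpDr // Im_mulrn mulrn_wge0 //.
Qed.

End Stability.

(** * Stirling permutations are the words generated by insertion, each once *)

Lemma subseq_consP (x0 a : nat) (l s : seq nat) :
  reflect (exists i, [/\ (i < size s)%N, nth x0 s i = a & subseq l (drop i.+1 s)])
          (subseq (a :: l) s).
Proof.
elim: s => [|b s IHs]; first by constructor; case=> i [].
have [->|ne_ba] := eqVneq b a.
  rewrite /= eqxx; apply: (iffP idP) => [sub_l|[[|i] [lt_i nth_i sub_l]]].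
  - by exists 0%N; rewrite /= drop0.
  - by rewrite /= drop0 in sub_l.
  - by apply: subseq_trans sub_l _; apply: drop_subseq.
rewrite /= (eq_sym a) (negPf ne_ba).
apply: (iffP IHs) => [[i Hi]|[[|i] [lt_i nth_i sub_l]]]; first by exists i.+1.
  by rewrite /= in nth_i; rewrite nth_i eqxx in ne_ba.
by exists i.
Qed.

(* For words in which no letter occurs three times, this is the condition of
   Stirling permutations; [a = b] is not excluded from the quantification. *)
Definition nested (s : seq nat) : Prop :=
  forall a b, subseq [:: a; b; a] s -> (a < b)%N.

Lemma nestedP (s : seq nat) :
  nested s <-> (forall i j k, (i < k < j)%N -> (j < size s)%N ->
                  nth 0%N s i = nth 0%N s j -> (nth 0%N s i < nth 0%N s k)%N).
Proof.
split=> [nest_s i j k /andP[lt_ik lt_kj] lt_js eq_ij|nest_s a b].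
  apply: nest_s; rewrite {2}eq_ij; apply/(subseq_consP 0%N); exists i.
  split=> //; first by lia.
  apply/(subseq_consP 0%N); exists (k - i.+1)%N.
  rewrite size_drop nth_drop drop_drop; split; [lia|congr nth; lia|].
  rewrite sub1seq; have -> : ((k - i.+1).+1 + i.+1 = k.+1)%N by lia.
  have -> : j = (k.+1 + (j - k.+1))%N by lia.
  rewrite -nth_drop; apply: mem_nth; rewrite size_drop.
  exact: ltn_sub2r (leq_ltn_trans lt_kj lt_js) lt_js.
move=> /(subseq_consP 0%N)[i [lt_i <-]] /(subseq_consP 0%N)[k []].
rewrite size_drop nth_drop drop_drop => lt_k <-.
rewrite sub1seq => /(nthP 0%N)[j]; rewrite size_drop nth_drop => lt_j eq_j.
apply: (nest_s i ((k.+1 + i.+1) + j)%N) => //; last by rewrite -ltn_subRL.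
by apply/andP; split; lia.
Qed.

Definition stirling_word (n : nat) (s : seq nat) : Prop :=
  perm_eq s (iota 1 n ++ iota 1 n) /\ nested s.

Lemma iota1S n : iota 1 n.+1 = rcons (iota 1 n) n.+1.
Proof. by have := iotaD 1 n 1; rewrite addn1 add1n cats1. Qed.

Lemma perm_iota2S n s1 s2 :
  perm_eq (s1 ++ n.+1 :: n.+1 :: s2) (iota 1 n.+1 ++ iota 1 n.+1) =
  perm_eq (s1 ++ s2) (iota 1 n ++ iota 1 n).
Proof.
by apply/permP/permP => eq_count P; have := eq_count P;
  rewrite iota1S -cats1 !count_cat /=; lia.
Qed.

Lemma subseq_cat_notin (m : nat) l s1 s2 :
  m \notin s1 -> subseq (m :: l) (s1 ++ m :: s2) = subseq l s2.
Proof.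
elim: s1 => [|c s1 IHs] /=; first by rewrite eqxx.
by rewrite inE negb_or => /andP[/negPf-> /IHs].
Qed.

(** In a subword [a b a], [a = m] is impossible because the only two copies of [m] are adjacent, and
    [b = m] gives [a < m]. Otherwise the subword survives the deletion of [m]. *)
Lemma nested_insertion m s1 s2 :
  all (ltn^~ m) (s1 ++ s2) -> nested (s1 ++ s2) -> nested (s1 ++ m :: m :: s2).
Proof.
move=> lt_s nest_s a b sub_s.
have m_notin := notin_bounded lt_s.
have [eq_am|ne_am] := eqVneq a m.
  have [m1 m2] : m \notin s1 /\ m \notin s2.
    by apply/andP; rewrite -negb_or -mem_cat.
  move: sub_s; rewrite eq_am subseq_cat_notin // => sub_bm.
  have : subseq [:: m] s2.
    move: sub_bm; rewrite [subseq _ _]/=; case: eqP => // _.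
    exact: subseq_trans (subseq_cons _ b).
  by rewrite sub1seq (negPf m2).
have [->|ne_bm] := eqVneq b m.
  have : a \in s1 ++ m :: m :: s2 by apply: (mem_subseq sub_s); rewrite mem_head.
  by rewrite mem_cat !inE (negPf ne_am) /= -mem_cat; apply: (allP lt_s).
apply: nest_s.
have <- : [seq c <- s1 ++ m :: m :: s2 | c != m] = s1 ++ s2.
  rewrite filter_cat /= eqxx /= -filter_cat; apply/all_filterP/allP => c c_in.
  by apply: contraTneq c_in => ->.
by rewrite subseq_filter sub_s /= ne_am ne_bm.
Qed.

Lemma stirling_word_bounded n s : stirling_word n s -> all (ltn^~ n.+1) s.
Proof.
move=> [perm_s _]; apply/allP => c.
by rewrite (perm_mem perm_s) mem_cat orbb mem_iota => /andP[].
Qed.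

(** A letter between the two copies of [n.+1] would have to be larger, so they are adjacent and can
    be deleted together. *)
Lemma stirling_wordS n s :
  stirling_word n.+1 s <-> exists2 r, stirling_word n r & s \in insertions n.+1 r.
Proof.
split=> [st_s|[r st_r /insertionsP[s1 [s2 [eq_r ->]]]]]; last first.
  have := stirling_word_bounded st_r; case: st_r; rewrite eq_r => perm_r nest_r lt_r.
  by split; [rewrite perm_iota2S|apply: nested_insertion].
have lt_s := stirling_word_bounded st_s; case: st_s => perm_s nest_s.
have count2 : count_mem n.+1 s = 2.
  rewrite (permP perm_s) iota1S -cats1 !count_cat /= eqxx.
  by rewrite (count_memPn _) // mem_iota; lia.
have [u [v [w eq_s]]] : exists u v w, s = u ++ n.+1 :: v ++ n.+1 :: w.
  have m_in : n.+1 \in s by rewrite -has_pred1 has_count count2.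
  have [s1 [t eq_s]] : exists s1 t, s = s1 ++ n.+1 :: t.
    by case/splitPr: m_in => s1 t; exists s1, t.
  have : n.+1 \in s1 ++ t.
    rewrite -has_pred1 has_count count_cat.
    by move: count2; rewrite eq_s count_cat /= eqxx; lia.
  rewrite mem_cat => /orP[] m_in'; rewrite eq_s; case/splitPr: m_in' => u v.
    by exists u, v, t; rewrite -catA.
  by exists s1, u, v.
have v_nil : v = [::].
  case: v eq_s => [//|c v] eq_s.
  have /nest_s : subseq [:: n.+1; c; n.+1] s.
    rewrite eq_s; apply: subseq_trans (suffix_subseq _ _).
    rewrite /= !eqxx; apply: subseq_trans (suffix_subseq _ _).
    by rewrite sub1seq mem_head.
  have : (c < n.+2)%N by apply: (allP lt_s); rewrite eq_s !(inE, mem_cat) eqxx !orbT.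
  by rewrite ltnS leqNgt => /negPf->.
have {v_nil} eq_s : s = u ++ n.+1 :: n.+1 :: w by rewrite eq_s v_nil.
exists (u ++ w); last by apply/insertionsP; exists u, w.
split; first by rewrite -perm_iota2S -eq_s.
move=> a b sub_ab; apply: nest_s; apply: subseq_trans sub_ab _.
rewrite eq_s subseq_cat2l; exact: subseq_trans (subseq_cons _ _) (subseq_cons _ _).
Qed.

Lemma mem_stirling_words n s : s \in stirling_words n <-> stirling_word n s.
Proof.
elim: n s => [|n IHn] s.
  rewrite inE; split=> [/eqP->|[/perm_nilP-> //]]; split=> // a b.
split=> [/stirling_wordsS[r /IHn st_r s_in]|/stirling_wordS[r /IHn r_in s_in]].
  by apply/stirling_wordS; exists r.
by apply/stirling_wordsS; exists r.
Qed.

Lemma uniq_insertions m s : m \notin s -> uniq (insertions m s).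
Proof.
elim: s => [//|b s IHs]; rewrite inE negb_or => /andP[ne_mb /IHs uniq_s] /=.
rewrite map_inj_uniq ?uniq_s ?andbT => [|u v []//].
by apply/negP => /mapP[u _ [eq_mb _]]; rewrite eq_mb eqxx in ne_mb.
Qed.

(** Erasing [m] from [u] recovers the original word. *)
Lemma insertions_inj m s s' u :
  m \notin s -> m \notin s' -> u \in insertions m s -> u \in insertions m s' -> s = s'.
Proof.
have filterE r : m \notin r -> u \in insertions m r -> r = [seq c <- u | c != m].
  move=> m_notin /insertionsP[s1 [s2 [eq_r ->]]].
  rewrite filter_cat /= eqxx /= -filter_cat -eq_r; apply/esym/all_filterP/allP => c c_in.
  by apply: contraNneq m_notin => <-.
by move=> /filterE Es /filterE Es' /Es-> /Es'->.
Qed.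

Lemma uniq_stirling_words n : uniq (stirling_words n).
Proof.
have notin s : s \in stirling_words n -> n.+1 \notin s.
  by move=> /well_marked_stirling_words[/notin_bounded].
elim: n notin => [//|n IHn] notin /=.
apply: allpairs_uniq_dep => [|s s_in|].
- by apply: IHn => s /well_marked_stirling_words[/notin_bounded].
- by apply: uniq_insertions; have [/notin_bounded] := well_marked_stirling_words s_in.
- move=> _ _ /allpairsPdep[s [u [s_in u_in ->]]]
    /allpairsPdep[s' [u' [s'_in u'_in ->]]] /=.
  move=> eq_u; rewrite -{}eq_u in u'_in *.
  have [/notin_bounded m_s _] := well_marked_stirling_words s_in.
  have [/notin_bounded m_s' _] := well_marked_stirling_words s'_in.
  by rewrite (insertions_inj m_s m_s' u_in u'_in).
Qed.

(** * From words of naturals to tuples of ordinals and the polynomial *)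

Section Words.
Variable n : nat.
Implicit Type p : word n.

Definition values p : seq nat := [seq (val a).+1 | a <- p].

Lemma values_inj : injective values.
Proof.
by move=> p q /inj_map eq_pq; apply/val_inj/eq_pq => a b [] /val_inj.
Qed.

Lemma size_values p : size (values p) = n.*2.
Proof. by rewrite size_map size_tuple. Qed.

Lemma nth_values p (i : 'I_n.*2) : nth 0%N (values p) i = (tnth p i).+1.
Proof.
rewrite (nth_map (tnth p i)) ?size_tuple //.
by rewrite -tnth_nth.
Qed.

Lemma is_stirlingP p : reflect (stirling_word n (values p)) (is_stirling p).
Proof.
have perm_p : perm_eq (values p) (iota 1 n ++ iota 1 n) =
    perm_eq p (enum 'I_n ++ enum 'I_n).
  have -> : iota 1 n ++ iota 1 n = [seq (val a).+1 | a <- enum 'I_n ++ enum 'I_n].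
    have -> : iota 1 n = [seq (val a).+1 | a <- enum 'I_n].
      by rewrite (map_comp S val) val_enum_ord -[1%N]addn0 iotaDl; apply: eq_map.
    by rewrite map_cat.
  by apply/idP/idP => [/perm_map_inj|/perm_map]; apply=> a b [] /val_inj.
apply: (iffP andP) => -[perm_s nest]; (split; first by rewrite ?perm_p // -perm_p).
  apply/nestedP => i j k /andP[lt_ik lt_kj]; rewrite size_values => lt_j.
  have lt_k := ltn_trans lt_kj lt_j; have lt_i := ltn_trans lt_ik lt_k.
  rewrite (nth_values p (Ordinal lt_i)) (nth_values p (Ordinal lt_j)).
  rewrite (nth_values p (Ordinal lt_k)) => -[] /val_inj eq_ij; rewrite ltnS.
  have /forallP/(_ (Ordinal lt_j))/forallP/(_ (Ordinal lt_k)) :=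
    forallP nest (Ordinal lt_i).
  by rewrite eq_ij eqxx lt_ik lt_kj.
apply/forallP=> i; apply/forallP=> j; apply/forallP=> k.
apply/implyP => /and3P[/eqP eq_ij lt_ik lt_kj].
rewrite -ltnS -!nth_values; move/nestedP: nest => /(_ i j k); apply.
- by rewrite lt_ik.
- by rewrite size_values.
- by rewrite !nth_values eq_ij.
Qed.

Lemma entryS p (i : 'I_n.*2) : entry p i.+1 = (tnth p i).+1.
Proof. exact: nth_values. Qed.

Lemma entry_last p : entry p n.*2.+1 = 0%N.
Proof. by rewrite /entry nth_default //= size_values. Qed.

Lemma second_occurrenceE p (i : 'I_n.*2) :
  second_occurrence p i = (entry p i.+1 \in take i (values p)).
Proof.
rewrite entryS -map_take mem_map => [|a b [] /val_inj //].
apply/existsP/(nthP (tnth p i)) => [[j /andP[lt_ji /eqP <-]]|[j]].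
  exists (val j); first by rewrite size_take size_tuple ltn_ord.
  by rewrite nth_take // -tnth_nth.
rewrite size_take size_tuple ltn_ord => lt_ji; rewrite nth_take // => eq_j.
exists (Ordinal (ltn_trans lt_ji (ltn_ord i))); rewrite lt_ji /=.
by rewrite (tnth_nth (tnth p i)) /= eq_j.
Qed.

Lemma weight_values (A : comNzRingType) (x y z : nat -> A) p :
  (0 < n)%N ->
  weight x y z [::] 0 (rcons (values p) 0) =
  (\prod_(i in ascents p) x (entry p i.+1)) *
  (\prod_(i in descents p) y (entry p i.+1)) *
  (\prod_(i in plateaux p) z (entry p i.+1)) *+ 2 ^ #|markable p|.
Proof.
move=> n_gt0; have gap_weightE s a b : gap_weight x y z s a b =
    (if (a < b)%N then x b else 1) * (if (b < a)%N then y a else 1) *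
    (if a == b then z b else 1) * (if s && (a < b)%N then 2%:R else 1).
  rewrite /gap_weight; case: ltngtP => [lt|lt|->]; rewrite ?andbT ?andbF ?mul1r ?mulr1 //.
  by case: s; rewrite ?mulr_natr ?mulr1.
rewrite weight_nth; under [LHS]eq_bigr do rewrite gap_weightE.
have entryE k : nth 0%N (0%N :: rcons (values p) 0) k = entry p k.
  rewrite -rcons_cons nth_rcons /entry; case: ltngtP => // [lt|->].
    by rewrite nth_default // ltnW.
  by rewrite nth_default.
under [LHS]eq_bigr do rewrite !entryE.
pose sec k := entry p k \in take k (0%N :: rcons (values p) 0).
pose G k := (if (entry p k < entry p k.+1)%N then x (entry p k.+1) else 1)
  * (if (entry p k.+1 < entry p k)%N then y (entry p k) else 1) *
    (if entry p k == entry p k.+1 then z (entry p k.+1) else 1) *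
    (if sec k && (entry p k < entry p k.+1)%N then 2%:R else 1).
rewrite -[LHS]/(\prod_(k < size (rcons (values p) 0)) G k).
rewrite -(big_mkord xpredT G) size_rcons size_values big_mkord /G !big_split /=.
rewrite -[RHS]mulr_natr natrX; congr (_ * _ * _ * _).
(* There are [2n + 1] gaps but [2n] positions. Ascents and plateaux are indexed by the right end of
   a gap, so the last gap drops out; descents and marks by the left end, so the first one does. *)
- rewrite big_ord_recr /= entry_last ltn0 mulr1 [RHS]big_mkcond /=.
  by apply: eq_bigr => i _; rewrite inE.
- rewrite big_ord_recl /= mul1r [RHS]big_mkcond /=.
  by apply: eq_bigr => i _; rewrite inE.
(* The last gap falls from a positive letter to the boundary 0, so it is no plateau. *)
- have last_pos : (0 < entry p n.*2)%N.
    have lt_k : (n.*2.-1 < n.*2)%N by lia.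
    have -> : n.*2 = n.*2.-1.+1 by lia.
    by rewrite (entryS p (Ordinal lt_k)).
  rewrite big_ord_recr /= entry_last eqn0Ngt last_pos mulr1 [RHS]big_mkcond /=.
  by apply: eq_bigr => i _; rewrite inE.
- rewrite big_ord_recl /= mul1r -prodr_const [RHS]big_mkcond /=.
  apply: eq_bigr => i _; rewrite inE second_occurrenceE; congr (if _ && _ then _ else _).
  rewrite /sec /= inE -cats1 takel_cat; last by rewrite size_values ltnW ?ltn_ord.
  by rewrite entryS.
Qed.

Lemma big_stirling (A : nmodType) (F : seq nat -> A) : (0 < n)%N ->
  \sum_(p : word n | is_stirling p) F (values p) = \sum_(s <- stirling_words n) F s.
Proof.
move=> n_gt0; rewrite -big_filter -(big_map values xpredT); apply: perm_big.
apply: uniq_perm.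
- by rewrite (map_inj_uniq values_inj) filter_uniq // /index_enum -enumT enum_uniq.
- exact: uniq_stirling_words.
move=> s; apply/mapP/idP => [[p]|/mem_stirling_words st_s].
  by rewrite mem_filter => /andP[/is_stirlingP st_p _] ->; apply/mem_stirling_words.
have /eqP sz_s : size s == n.*2.
  by have [/perm_size->] := st_s; rewrite size_cat size_iota addnn.
(* The default letter is never reached, as the letters of [s] lie between 1 and [n]. *)
pose f c : 'I_n := insubd (Ordinal n_gt0) c.-1.
have sz_fs : size (map f s) == n.*2 by rewrite size_map sz_s.
have values_fs : values (Tuple sz_fs) = s.
  rewrite /values /= -map_comp map_id_in // => c c_in /=.
  have := allP (stirling_word_bounded st_s) c c_in.
  have : c \in iota 1 n ++ iota 1 n by rewrite -(perm_mem st_s.1).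
  rewrite mem_cat orbb mem_iota /= val_insubd.
  by case: c {c_in} => // c _; rewrite ltnS => ->.
exists (Tuple sz_fs) => //.
by rewrite mem_filter mem_index_enum andbT; apply/is_stirlingP; rewrite values_fs.
Qed.

(** Numbers beyond the alphabet are sent to its first letter, so the three sequences take values of
    [v] everywhere and keep positive imaginary parts. *)
Lemma meval_T_poly (R : realType) (v : 'I_(n + n + n) -> R[i]) (n_gt0 : (0 < n)%N) :
  let letter a : 'I_n := insubd (Ordinal n_gt0) a.-1 in
  (T_poly R n).@[v] =
  stirling_sum (fun a => v (xvar (letter a))) (fun a => v (yvar (letter a)))
    (fun a => v (zvar (letter a))) n.
Proof.
move=> letter; rewrite /stirling_sum -big_stirling //.
have letterE p (i : 'I_n.*2) : letter (entry p i.+1) = tnth p i.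
  by apply/val_inj; rewrite entryS val_insubd /= ltn_ord.
(* The power of 2 counts the subsets of [markable p], that is, the choices of marks. *)
under [RHS]eq_bigr do rewrite weight_values // -card_powerset -sumr_const.
rewrite rmorph_sum pair_big_dep /=; apply: eq_big => [q|q _].
  by rewrite !inE.
rewrite !rmorphM !rmorph_prod; congr (_ * _ * _);
  by apply: eq_bigr => i _; rewrite /= mevalXU letterE.
Qed.

End Words.

Theorem theorem5p5 (R : realType) (n : nat) (hn : (0 < n)%N) :
  stable (T_poly R n).
Proof.
by move=> v Im_v; rewrite (meval_T_poly v hn) stirling_sum_neq0.
Qed.
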